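(* Consider two SOPPs with item sets $\mathcal{I}$ and $\mathcal{J}$, arising from routes satisfying the routing constraints (R1)--(R3), where $\mathcal{I}$ is associated with a verified feasible packing plan (which determines the reference bins: the bin of an item of $\mathcal I$ is the rectangle that item occupies in this plan). Let $\mathcal{I}^{\mathrm p}$ and $\mathcal{J}^{\mathrm p}$ denote the corresponding item sequences indexed in the reverse order of pickup, and let $\mathcal{I}^{\mathrm d}$ and $\mathcal{J}^{\mathrm d}$ denote those indexed in the order of delivery. Suppose there exist two order-preserving mappings $f^{\mathrm p}:\mathcal{J}^{\mathrm p}\to\mathcal{I}^{\mathrm p}$ and $f^{\mathrm d}:\mathcal{J}^{\mathrm d}\to\mathcal{I}^{\mathrm d}$ such that: (i) for each $f\in\{f^{\mathrm p},f^{\mathrm d}\}$, the pieces of $\mathcal J$ can be placed so that each piece lies within the reference bin assigned to it by $f$, and, within each bin, the pieces assigned to it satisfy (P1), (P2) and (P3a); and (ii) such placements for $f^{\mathrm p}$ and for $f^{\mathrm d}$ can be chosen to be one common packing plan for $\mathcal{J}$, i.e., each item in $\mathcal{J}$ has the same position and orientation under the two placements. Then $\mathcal{J}$ is dominated by $\mathcal{I}$ and admits a feasible packing plan (satisfying (P1) and (P2) in the vehicle) that satisfies NR-p and NR-d simultaneously.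
   Context: **Setting.** A request $r$ has a pickup node, a delivery node and one rectangular item with positive side lengths (width $w$, length $l$). All vehicles have the same rectangular loading space $[0,W]\times[0,L]$; the $x$-axis spans the width and the $y$-axis the length. Loading and unloading are done only from the rear end $y=L$. A packing plan assigns to each item $j$ a bottom-left corner $(x_j,y_j)$ with $x_j,y_j\ge 0$ and a rotation $\xi_j\in\{0,1\}$; its effective dimensions are $(\bar w_j,\bar l_j)=(w_j,l_j)$ if $\xi_j=0$ and $(l_j,w_j)$ if $\xi_j=1$, and it occupies $[x_j,x_j+\bar w_j]\times[y_j,y_j+\bar l_j]$. **Routing constraints.** (R1) each route starts and ends at the depot; (R2) each request is assigned to exactly one vehicle and its pickup and delivery nodes are visited exactly once; (R3) the route length does not exceed a prescribed limit. A pickup precedes the corresponding delivery. These constraints do not restrict placements. **Packing constraints.** (P1) each item lies entirely within the loading space (or within the bin considered) and no two items overlap, i.e. for $j\ne j'$ one of $x_j+\bar w_j\le x_{j'}$, $x_{j'}+\bar w_{j'}\le x_j$, $y_j+\bar l_j\le y_{j'}$, $y_{j'}+\bar l_{j'}\le y_j$ holds. (P2) items may be rotated by $90^\circ$. (P3a) operation accessibility, consisting of the two conditions NR-p and NR-d. Say that $j$ is rear-accessible relative to $j'$ if $x_j+\bar w_j\le x_{j'}$ or $x_{j'}+\bar w_{j'}\le x_j$ or $y_j\ge y_{j'}+\bar l_{j'}$. NR-p: $j$ is rear-accessible relative to $j'$ whenever $j$ is picked up later than $j'$. NR-d: $j$ is rear-accessible relative to $j'$ whenever $j$ is delivered earlier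 than $j'$. A constraint holds ''within a bin'' if it holds for the pieces assigned to that bin with the bin rectangle as container. **SOPP.** A sequence of open pickup points (SOPP) of a route is a sequence of pickup nodes such that the last one is immediately followed in the route by a delivery node, and the sequence contains exactly all pickup nodes, up to and including its last pickup node, whose delivery nodes appear after this last pickup node in the route. Its item set consists of the items of these pickups (all simultaneously onboard on the arc right after the last pickup). The pickup and delivery orders of the items are those in the route. A (verified) feasible packing plan of an SOPP is a packing plan of its item set satisfying (P1), (P2), (P3a). **Order-preserving mapping (OPM).** For item sequences $\mathcal I$ (bins) and $\mathcal J$ (pieces) indexed by the same rule (both reverse pickup order, or both delivery order), $f:\mathcal J\to\mathcal I$ is an OPM if $f(j+1)\ge f(j)$ for all consecutive pieces $j,j+1$, where bins are compared by their position in the sequence $\mathcal I$. **''Dominated''.** ''$\mathcal J$ is dominated by $\mathcal I$'' is the name for the situation in which two such OPMs exist, so that feasibility of $\mathcal J$ is inferred from the verified plan of $\mathcal I$; it carries no further content. *)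

(* Defs.v *)
From HB Require Import structures.
From mathcomp Require Import all_boot all_order all_algebra.
Set Implicit Arguments.
Unset Strict Implicit.
Unset Printing Implicit Defensive.
Import Order.TTheory GRing.Theory Num.Theory.
Local Open Scope ring_scope.

Inductive node (T : Type) : Type :=
| Depot
| Pickup of T
| Delivery of T.
Arguments Depot {T}.

Definition node_code (T : Type) (n : node T) : option (T + T) :=
  match n with
  | Depot => None
  | Pickup r => Some (inl r)
  | Delivery r => Some (inr r)
  end.

Definition node_decode (T : Type) (c : option (T + T)) : node T :=
  match c with
  | None => Depot
  | Some (inl r) => Pickup r
  | Some (inr r) => Delivery r
  end.

Lemma node_codeK (T : Type) : cancel (@node_code T) (@node_decode T).
Proof. by case. Qed.

HB.instance Definition _ (T : eqType) :=
  Equality.copy (node T) (can_type (@node_codeK T)).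

(* Every request carries exactly one item, so requests also serve as the names
   of the items.  The loading space is [0, space_width] x [0, space_length],
   with its rear end at y = space_length. *)
Record instance (R : realFieldType) := Instance {
  request : finType;
  vehicle : finType;
  item_width : request -> R;
  item_length : request -> R;
  item_width_gt0 : forall r, 0 < item_width r;
  item_length_gt0 : forall r, 0 < item_length r;
  space_width : R;
  space_length : R;
  distance : node request -> node request -> R;
  max_route_length : R
}.

Section Routing.
Variables (R : realFieldType) (X : instance R).

Definition route : Type := seq (node (request X)).

Definition routing : Type := vehicle X -> route.

Definition depot_to_depot (rt : route) : Prop :=
  exists s : route, rt = Depot :: rcons s Depot.

Definition served_once (S : routing) (r : request X) : Prop :=
  exists v : vehicle X,
    [/\ count_mem (Pickup r) (S v) = 1%N,
        count_mem (Delivery r) (S v) = 1%N &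
        forall v', v' != v -> Pickup r \notin S v' /\ Delivery r \notin S v'].

Definition route_length (rt : route) : R :=
  \sum_(e <- zip rt (behead rt)) distance e.1 e.2.

Definition pickup_before_delivery (rt : route) : Prop :=
  forall r : request X, Pickup r \in rt ->
    (index (Pickup r) rt < index (Delivery r) rt)%N.

Definition routing_feasible (S : routing) : Prop :=
  [/\ forall v, depot_to_depot (S v),
      forall r, served_once S r,
      forall v, route_length (S v) <= max_route_length X &
      forall v, pickup_before_delivery (S v)].

Definition delivered_in (post : route) (n : node (request X)) : bool :=
  if n is Pickup r then Delivery r \in post else false.

(* The route is cut right after the last pickup node of the sequence; the
   sequence lists, in route order, all pickup nodes of the first part whose
   delivery nodes lie in the second part. *)
Definition is_SOPP (rt : route) (s : seq (node (request X))) : Prop :=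
  exists (s0 pre post : route) (r r' : request X),
    [/\ rt = rcons pre (Pickup r) ++ Delivery r' :: post,
        s = rcons s0 (Pickup r) &
        s = [seq n <- rcons pre (Pickup r)
            | delivered_in (Delivery r' :: post) n]].

Definition item_set (s : seq (node (request X))) : {set request X} :=
  [set r | Pickup r \in s].

Definition picked_up_later (rt : route) (j j' : request X) : bool :=
  (index (Pickup j') rt < index (Pickup j) rt)%N.

Definition delivered_earlier (rt : route) (j j' : request X) : bool :=
  (index (Delivery j) rt < index (Delivery j') rt)%N.

Definition reverse_pickup_seq (rt : route) (A : {set request X}) :
    seq (request X) :=
  rev [seq r <- pmap (fun n => if n is Pickup r then Some r else None) rt
      | r \in A].

Definition delivery_seq (rt : route) (A : {set request X}) :
    seq (request X) :=
  [seq r <- pmap (fun n => if n is Delivery r then Some r else None) rt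
  | r \in A].

(* [sorted] compares consecutive pieces of [J]; bins are compared by their
   position in [I].  Values of [f] outside [J] are irrelevant. *)
Definition is_OPM (J I : seq (request X)) (f : request X -> request X) : Prop :=
  {in J, forall j, f j \in I} /\ sorted leq [seq index (f j) I | j <- J].

End Routing.

(* [rotated] is unconstrained, so rotation by 90 degrees is always allowed. *)
Record placement (R : realFieldType) := Placement {
  corner_x : R;
  corner_y : R;
  rotated : bool
}.

(* The rectangle [rect_x, rect_x + rect_w] x [rect_y, rect_y + rect_l]. *)
Record rectangle (R : realFieldType) := Rectangle {
  rect_x : R;
  rect_y : R;
  rect_w : R;
  rect_l : R
}.

Section Packing.
Variables (R : realFieldType) (X : instance R).

Definition within (a c : rectangle R) : Prop :=
  [/\ rect_x c <= rect_x a,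
      rect_x a + rect_w a <= rect_x c + rect_w c,
      rect_y c <= rect_y a &
      rect_y a + rect_l a <= rect_y c + rect_l c].

Definition non_overlapping (a b : rectangle R) : Prop :=
  [\/ rect_x a + rect_w a <= rect_x b,
      rect_x b + rect_w b <= rect_x a,
      rect_y a + rect_l a <= rect_y b |
      rect_y b + rect_l b <= rect_y a].

Definition rear_accessible (a b : rectangle R) : Prop :=
  [\/ rect_x a + rect_w a <= rect_x b,
      rect_x b + rect_w b <= rect_x a |
      rect_y b + rect_l b <= rect_y a].

Definition packing_plan : Type := request X -> placement R.

Definition occupied (Q : packing_plan) (j : request X) : rectangle R :=
  let p := Q j in
  Rectangle (corner_x p) (corner_y p)
    (if rotated p then item_length j else item_width j)
    (if rotated p then item_width j else item_length j).

Definition loading_space : rectangle R :=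
  Rectangle 0 0 (space_width X) (space_length X).

Definition P1 (c : rectangle R) (A : {set request X}) (Q : packing_plan) :
    Prop :=
  {in A, forall j, within (occupied Q j) c} /\
  {in A &, forall j j', j != j' ->
    non_overlapping (occupied Q j) (occupied Q j')}.

Definition NRp (rt : route X) (A : {set request X}) (Q : packing_plan) : Prop :=
  {in A &, forall j j', picked_up_later rt j j' ->
    rear_accessible (occupied Q j) (occupied Q j')}.

Definition NRd (rt : route X) (A : {set request X}) (Q : packing_plan) : Prop :=
  {in A &, forall j j', delivered_earlier rt j j' ->
    rear_accessible (occupied Q j) (occupied Q j')}.

Definition feasible_in (c : rectangle R) (rt : route X) (A : {set request X})
    (Q : packing_plan) : Prop :=
  [/\ P1 c A Q, NRp rt A Q & NRd rt A Q].

(* The bin of an item [i] of [I] is the rectangle [occupied P i], and positions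
   of pieces are given in the coordinates of the vehicle.  [P1] for a bin
   contains the requirement that its pieces lie within it. *)
Definition feasible_in_bins (I : {set request X}) (P : packing_plan)
    (rt : route X) (J : {set request X}) (f : request X -> request X)
    (Q : packing_plan) : Prop :=
  {in I, forall i, feasible_in (occupied P i) rt [set j in J | f j == i] Q}.

Definition common_bin_placement (I : {set request X}) (P : packing_plan)
    (rt : route X) (J : {set request X}) (fp fd : request X -> request X) :
    Prop :=
  exists Qp Qd : packing_plan,
    [/\ feasible_in_bins I P rt J fp Qp,
        feasible_in_bins I P rt J fd Qd &
        {in J, forall j, Qp j = Qd j}].

(* [J], with orders from [rtJ], is dominated by [I], with orders from [rtI]
   and reference bins from [P]. *)
Definition dominated (rtJ : route X) (J : {set request X})
    (rtI : route X) (I : {set request X}) (P : packing_plan) : Prop :=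
  exists fp fd : request X -> request X,
    [/\ is_OPM (reverse_pickup_seq rtJ J) (reverse_pickup_seq rtI I) fp,
        is_OPM (delivery_seq rtJ J) (delivery_seq rtI I) fd &
        common_bin_placement I P rtJ J fp fd].

End Packing.
Arguments loading_space {R} X.

(* Main.v *)
Require Import Defs.
From mathcomp Require Import all_boot all_order all_algebra.

(** The common packing plan [Q] of the pieces is itself the plan sought.

    Take two pieces.  If they share a bin, the conditions within that bin say
    exactly what is needed.  If they lie in different bins, they inherit
    whatever separates the two bins, because shrinking rectangles preserves
    containment, non-overlap and rear accessibility ([within_trans],
    [non_overlapping_within], [rear_accessible_within]).  The bins are the
    rectangles of a verified plan, so they never overlap, and a bin is rear
    accessible relative to another one when its item is picked up later
    (or delivered earlier).

    What makes the bins come in the right order is the mapping: if a piece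
    comes before another one in the sequence of pieces, an order-preserving map
    sends it to the same bin or to a bin that comes strictly before the other
    one in the sequence of bins ([OPM_index]).  In the reverse pickup sequence,
    coming before means being picked up later, and in the delivery sequence it
    means being delivered earlier ([picked_up_laterE], [delivered_earlierE]).
    Hence [fp] gives NR-p and [fd] gives NR-d ([bins_rear_accessible]).  The
    two conditions hold for one plan because the placements for [fp] and [fd]
    coincide. *)

Set Implicit Arguments.
Unset Strict Implicit.
Unset Printing Implicit Defensive.
Import Order.TTheory.

(** * Pieces inherit the relative position of their bins *)

Lemma within_trans (R : realFieldType) (a b c : rectangle R) :
  within a b -> within b c -> within a c.
Proof.
move=> [x1 x2 y1 y2] [x1' x2' y1' y2'].
by split; [exact: le_trans x1' x1 | exact: le_trans x2 x2'
          | exact: le_trans y1' y1 | exact: le_trans y2 y2'].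
Qed.

Lemma non_overlapping_within (R : realFieldType) (a b c d : rectangle R) :
  within a c -> within b d -> non_overlapping c d -> non_overlapping a b.
Proof.
move=> [ax1 ax2 ay1 ay2] [bx1 bx2 by1 by2] [] H.
- by apply: Or41; exact: le_trans ax2 (le_trans H bx1).
- by apply: Or42; exact: le_trans bx2 (le_trans H ax1).
- by apply: Or43; exact: le_trans ay2 (le_trans H by1).
- by apply: Or44; exact: le_trans by2 (le_trans H ay1).
Qed.

Lemma rear_accessible_within (R : realFieldType) (a b c d : rectangle R) :
  within a c -> within b d -> rear_accessible c d -> rear_accessible a b.
Proof.
move=> [ax1 ax2 ay1 ay2] [bx1 bx2 by1 by2] [] H.
- by apply: Or31; exact: le_trans ax2 (le_trans H bx1).
- by apply: Or32; exact: le_trans bx2 (le_trans H ax1).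
- by apply: Or33; exact: le_trans by2 (le_trans H ay1).
Qed.

(** * Positions in projected, restricted and reversed sequences *)

Lemma ltn_index_filter (T : eqType) (p : pred T) (s : seq T) (x y : T) :
  p x -> p y ->
  (index x (filter p s) < index y (filter p s))%N
    = (index x s < index y s)%N.
Proof.
move=> px py; elim: s => //= z s IHs; case pz: (p z) => /=.
  by case: (z == x); case: (z == y); rewrite ?ltnS.
have neq t : p t -> (z == t) = false.
  by move=> pt; apply/eqP => zt; rewrite zt pt in pz.
by rewrite !neq ?ltnS.
Qed.

(** Here [g] recognizes the nodes of the form [c r]; it serves for [c] the
    constructor [Pickup] or [Delivery]. *)
Lemma ltn_index_pmap (T U : eqType) (g : T -> option U) (c : U -> T)
    (s : seq T) (x y : U) :
  pcancel c g -> ocancel g c ->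
  (index x (pmap g s) < index y (pmap g s))%N
    = (index (c x) s < index (c y) s)%N.
Proof.
move=> cK gK; elim: s => //= z s IHs.
case gz: (g z) => [t|] /=.
  have <- : c t = z by have := gK z; rewrite gz.
  rewrite !(inj_eq (pcan_inj cK)).
  by case: (t == x); case: (t == y); rewrite ?ltnS.
have neq u : (z == c u) = false.
  by apply/eqP => zu; rewrite zu cK in gz.
by rewrite !neq ltnS.
Qed.

Lemma index_rev (T : eqType) (s : seq T) (x : T) :
  uniq s -> x \in s -> (index x (rev s) + index x s).+1 = size s.
Proof.
elim: s => //= z s IHs /andP [zs us]; rewrite inE rev_cons -cats1 index_cat.
rewrite mem_rev eq_sym; case: eqVneq => [<- _ | _ /= xs].
  by rewrite (negbTE zs) /= eqxx size_rev !addn0.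
by rewrite xs addnS IHs.
Qed.

Lemma ltn_index_rev (T : eqType) (s : seq T) :
  uniq s -> {in s &, forall x y,
    (index x (rev s) < index y (rev s))%N = (index y s < index x s)%N}.
Proof.
move=> us x y /(index_rev us) Ex /(index_rev us) Ey.
by rewrite -(ltn_add2r (index x s)) (succn_inj (etrans Ex (esym Ey))) ltn_add2l.
Qed.

(** * Items in pickup and delivery order along a route *)

Definition pickup_of (T : Type) (n : node T) : option T :=
  if n is Pickup r then Some r else None.

Definition delivery_of (T : Type) (n : node T) : option T :=
  if n is Delivery r then Some r else None.

Lemma Pickup_inK (T : Type) : pcancel (@Pickup T) (@pickup_of T).
Proof. by []. Qed.

Lemma pickup_ofK (T : Type) : ocancel (@pickup_of T) (@Pickup T).
Proof. by case. Qed.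

Lemma Delivery_inK (T : Type) : pcancel (@Delivery T) (@delivery_of T).
Proof. by []. Qed.

Lemma delivery_ofK (T : Type) : ocancel (@delivery_of T) (@Delivery T).
Proof. by case. Qed.

Lemma mem_reverse_pickup_seq (R : realFieldType) (X : instance R)
    (rt : route X) (A : {set request X}) (r : request X) :
  (r \in reverse_pickup_seq rt A) = (r \in A) && (Pickup r \in rt).
Proof.
rewrite mem_rev mem_filter; congr andb.
rewrite -(mem_map (pcan_inj (@Pickup_inK (request X)))).
by rewrite (pmap_filter (@pickup_ofK _)) mem_filter.
Qed.

Lemma mem_delivery_seq (R : realFieldType) (X : instance R)
    (rt : route X) (A : {set request X}) (r : request X) :
  (r \in delivery_seq rt A) = (r \in A) && (Delivery r \in rt).
Proof.
rewrite mem_filter; congr andb.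
rewrite -(mem_map (pcan_inj (@Delivery_inK (request X)))).
by rewrite (pmap_filter (@delivery_ofK _)) mem_filter.
Qed.

(** A request served once has a single pickup node over all routes, so no
    pickup is repeated on a given route.  Reversal exchanges the order of first
    occurrences only in the absence of repetitions, so NR-p relies on this. *)
Lemma uniq_pickups (R : realFieldType) (X : instance R) (S : routing X)
    (v : vehicle X) :
  routing_feasible S -> uniq (pmap (@pickup_of (request X)) (S v)).
Proof.
move=> [_ served _ _]; rewrite -(map_inj_uniq (pcan_inj (@Pickup_inK _))).
rewrite (pmap_filter (@pickup_ofK _)); apply: count_mem_uniq => n.
rewrite count_filter mem_filter; case: n => [|r|r] /=.
- by apply/eqP; rewrite -leqn0 leqNgt -has_count; apply/hasPn => - [].
- have -> : count (predI (pred1 (Pickup r)) (@pickup_of (request X))) (S v)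
      = count_mem (Pickup r) (S v).
    by apply: eq_count => - [|q|q] //=; rewrite andbT.
  have [u [cp _ others]] := served r.
  have [->|vu] := eqVneq v u.
    by rewrite cp -has_pred1 has_count cp.
  have [np _] := others _ vu.
  by rewrite (negbTE np); apply/eqP; rewrite -leqn0 leqNgt -has_count has_pred1.
- apply/eqP; rewrite -leqn0 leqNgt -has_count; apply/hasPn => - [|q|q] _ //=.
  by rewrite andbF.
Qed.

Lemma SOPP_served (R : realFieldType) (X : instance R) (rt : route X)
    (s : seq (node (request X))) (r : request X) :
  is_SOPP rt s -> r \in item_set s -> (Pickup r \in rt) && (Delivery r \in rt).
Proof.
move=> [s0 [pre [post [q [q' [-> _ ->]]]]]].
by rewrite inE mem_filter !mem_cat => /= /andP [-> ->]; rewrite orbT.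
Qed.

Lemma picked_up_laterE (R : realFieldType) (X : instance R) (S : routing X)
    (v : vehicle X) (A : {set request X}) :
  routing_feasible S ->
  {in reverse_pickup_seq (S v) A &, forall j j',
    picked_up_later (S v) j j' =
      (index j (reverse_pickup_seq (S v) A)
         < index j' (reverse_pickup_seq (S v) A))%N}.
Proof.
move=> /(uniq_pickups v) us j j'.
rewrite /reverse_pickup_seq !mem_rev => js js'.
rewrite ltn_index_rev ?filter_uniq //.
move: js js'; rewrite !mem_filter => /andP [jA _] /andP [j'A _].
rewrite ltn_index_filter //.
by rewrite (ltn_index_pmap _ _ _ (@Pickup_inK _) (@pickup_ofK _)).
Qed.

Lemma delivered_earlierE (R : realFieldType) (X : instance R) (rt : route X)
    (A : {set request X}) :
  {in delivery_seq rt A &, forall j j',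
    delivered_earlier rt j j' =
      (index j (delivery_seq rt A) < index j' (delivery_seq rt A))%N}.
Proof.
move=> j j'; rewrite !mem_filter => /andP [jA _] /andP [j'A _].
rewrite ltn_index_filter //.
by rewrite (ltn_index_pmap _ _ _ (@Delivery_inK _) (@delivery_ofK _)).
Qed.

(** * From bins to the vehicle *)

(** Monotonicity gives a weak inequality between bin positions; equal positions
    mean equal bins, which leaves a strict inequality between distinct bins. *)
Lemma OPM_index (R : realFieldType) (X : instance R) (J I : seq (request X))
    (f : request X -> request X) :
  is_OPM J I f ->
  {in J &, forall j j', (index j J < index j' J)%N ->
    f j = f j' \/ (index (f j) I < index (f j') I)%N}.
Proof.
move=> [fI]; rewrite sorted_map => sJ j j' jJ j'J lt_jj'.
have tr : transitive (relpre (fun k => index (f k) I) leq).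
  by move=> b a c; exact: leq_trans.
have := sorted_ltn_index tr sJ j j' jJ j'J lt_jj'.
rewrite /= leq_eqVlt => /orP [/eqP eq_idx|]; [left | by right].
by rewrite -(nth_index j (fI _ jJ)) eq_idx nth_index ?fI.
Qed.

(** Both NR-p and NR-d instantiate this: [laterJ] and [laterI] stand for either
    order relation on the two routes, and [sJ] and [sI] list the items so that
    an item must leave the way free for those listed before it. *)
Lemma bins_rear_accessible (R : realFieldType) (X : instance R)
    (I J : {set request X}) (sI sJ : seq (request X))
    (laterI laterJ : rel (request X)) (f : request X -> request X)
    (P Q : packing_plan X) :
  {subset J <= sJ} -> is_OPM sJ sI f ->
  {in sJ &, forall j j', laterJ j j' = (index j sJ < index j' sJ)%N} ->
  {in sI &, forall i i', laterI i i' = (index i sI < index i' sI)%N} ->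
  {in J, forall j, f j \in I} ->
  {in J, forall j, within (occupied Q j) (occupied P (f j))} ->
  {in I &, forall i i', laterI i i' ->
    rear_accessible (occupied P i) (occupied P i')} ->
  {in J &, forall j j', f j = f j' -> laterJ j j' ->
    rear_accessible (occupied Q j) (occupied Q j')} ->
  {in J &, forall j j', laterJ j j' ->
    rear_accessible (occupied Q j) (occupied Q j')}.
Proof.
move=> subJ opm EJ EI fI wQ accP acc_bin j j' jJ j'J lt_jj'.
have [js j's] : j \in sJ /\ j' \in sJ by split; exact: subJ.
have := lt_jj'; rewrite EJ // => /(OPM_index opm js j's) [same|diff].
  exact: acc_bin.
apply: rear_accessible_within (wQ _ jJ) (wQ _ j'J) _.
by apply: accP; rewrite ?fI // EI // opm.1.
Qed.

Lemma P1_of_bins (R : realFieldType) (X : instance R) (c : rectangle R)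
    (I : {set request X}) (P : packing_plan X) (rt : route X)
    (J : {set request X}) (f : request X -> request X) (Q : packing_plan X) :
  P1 c I P -> {in J, forall j, f j \in I} ->
  feasible_in_bins I P rt J f Q -> P1 c J Q.
Proof.
move=> [wP novP] fI fQ.
have wQ : {in J, forall j, within (occupied Q j) (occupied P (f j))}.
  move=> j jJ; have [[wj _] _ _] := fQ _ (fI _ jJ).
  by apply: wj; rewrite inE jJ eqxx.
split=> [j jJ | j j' jJ j'J neq].
  by apply: within_trans (wQ _ jJ) _; apply: wP; exact: fI.
have [same|diff] := eqVneq (f j) (f j').
  have [[_ nov] _ _] := fQ _ (fI _ jJ).
  by apply: nov; rewrite // inE ?jJ ?j'J ?same eqxx.
apply: non_overlapping_within (wQ _ jJ) (wQ _ j'J) _.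
by apply: novP; rewrite ?fI.
Qed.

Lemma feasible_in_bins_eq (R : realFieldType) (X : instance R)
    (I : {set request X}) (P : packing_plan X) (rt : route X)
    (J : {set request X}) (f : request X -> request X)
    (Q Q' : packing_plan X) :
  {in J, forall j, Q j = Q' j} ->
  feasible_in_bins I P rt J f Q' -> feasible_in_bins I P rt J f Q.
Proof.
move=> eqQ fQ' i iI; have [[w nov] nrp nrd] := fQ' i iI.
have eqO j : j \in [set j in J | f j == i] -> occupied Q j = occupied Q' j.
  by rewrite inE => /andP [jJ _]; rewrite /occupied eqQ.
split; first split.
- by move=> j jB; rewrite eqO //; exact: w.
- by move=> j j' jB j'B; rewrite !eqO //; exact: nov.
- by move=> j j' jB j'B; rewrite !eqO //; exact: nrp.
- by move=> j j' jB j'B; rewrite !eqO //; exact: nrd.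
Qed.

Theorem proposition2 (R : realFieldType) (X : instance R)
    (SI SJ : routing X) (vI vJ : vehicle X)
    (sI sJ : seq (node (request X))) (P : packing_plan X)
    (fp fd : request X -> request X) :
  routing_feasible SI -> routing_feasible SJ ->
  is_SOPP (SI vI) sI -> is_SOPP (SJ vJ) sJ ->
  feasible_in (loading_space X) (SI vI) (item_set sI) P ->
  is_OPM (reverse_pickup_seq (SJ vJ) (item_set sJ))
         (reverse_pickup_seq (SI vI) (item_set sI)) fp ->
  is_OPM (delivery_seq (SJ vJ) (item_set sJ))
         (delivery_seq (SI vI) (item_set sI)) fd ->
  common_bin_placement (item_set sI) P (SJ vJ) (item_set sJ) fp fd ->
  dominated (SJ vJ) (item_set sJ) (SI vI) (item_set sI) P /\
  exists Q : packing_plan X,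
    [/\ P1 (loading_space X) (item_set sJ) Q,
        NRp (SJ vJ) (item_set sJ) Q &
        NRd (SJ vJ) (item_set sJ) Q].
Proof.
move=> feasI feasJ _ soppJ [p1P nrpP nrdP] opm_p opm_d common.
split; first by exists fp, fd.
have [Q [Qd [fQp /feasible_in_bins_eq fQd_eq /fQd_eq fQd]]] := common.
set J := item_set sJ in opm_p opm_d fQp fQd *.
set I := item_set sI in p1P nrpP nrdP opm_p opm_d fQp fQd *.
have subp : {subset J <= reverse_pickup_seq (SJ vJ) J}.
  move=> j jJ; rewrite mem_reverse_pickup_seq jJ.
  by case/andP: (SOPP_served soppJ jJ).
have subd : {subset J <= delivery_seq (SJ vJ) J}.
  move=> j jJ; rewrite mem_delivery_seq jJ.
  by case/andP: (SOPP_served soppJ jJ).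
have fpI : {in J, forall j, fp j \in I}.
  by move=> j /subp /opm_p.1; rewrite mem_reverse_pickup_seq => /andP [].
have fdI : {in J, forall j, fd j \in I}.
  by move=> j /subd /opm_d.1; rewrite mem_delivery_seq => /andP [].
exists Q; split; first exact: P1_of_bins p1P fpI fQp.
- apply: (bins_rear_accessible subp opm_p _ _ fpI _ nrpP).
  + exact: picked_up_laterE.
  + exact: picked_up_laterE.
  + move=> j jJ; have [[w _] _ _] := fQp _ (fpI _ jJ).
    by apply: w; rewrite inE jJ eqxx.
  + move=> j j' jJ j'J same; have [_ nrp _] := fQp _ (fpI _ jJ).
    by apply: nrp; rewrite inE ?jJ ?j'J ?same eqxx.
- apply: (bins_rear_accessible subd opm_d _ _ fdI _ nrdP).
  + exact: delivered_earlierE.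
  + exact: delivered_earlierE.
  + move=> j jJ; have [[w _] _ _] := fQd _ (fdI _ jJ).
    by apply: w; rewrite inE jJ eqxx.
  + move=> j j' jJ j'J same; have [_ _ nrd] := fQd _ (fdI _ jJ).
    by apply: nrd; rewrite inE ?jJ ?j'J ?same eqxx.
Qed.
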